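(* Let $\pi\in S_n(123)$ and let $D_\pi$ be the Dyck path associated to $\pi$ by Krattenthaler's bijection (described in the context). Then $\pi$ is a backward derangement if and only if $D_\pi$ is hill-free.
   Context: Permutations are written in one-line notation $\pi=\pi_1\cdots\pi_n$. $S_n(123)$ is the set of permutations of $\{1,\dots,n\}$ avoiding the pattern $123$, i.e. having no indices $i<j<k$ with $\pi_i<\pi_j<\pi_k$. A permutation $\pi\in S_n$ is a backward derangement if $\pi_{n+1-i}\neq i$ for all $1\le i\le n$. A Dyck path of length $2n$ is a lattice path from $(0,0)$ to $(2n,0)$ consisting of up-steps $(1,1)$ and down-steps $(1,-1)$ never going below the $x$-axis. It contains a hill if it has a peak at height $1$ (an up-step from height $0$ to $1$ immediately followed by a down-step back to height $0$); it is hill-free if it contains no hill. Krattenthaler's bijection $\pi\mapsto D_\pi$ from $S_n(123)$ to Dyck paths of length $2n$: an entry $\pi_i$ is a right-to-left maximum if $\pi_i>\pi_j$ for all $j>i$. Let the right-to-left maxima be $m_1<m_2<\dots<m_s$ and write $\pi=w_s m_s w_{s-1}m_{s-1}\cdots w_1 m_1$ with $w_i$ (possibly empty) words. Set $m_0=0$. Build the path backwards, starting at $(2n,0)$ and ending at $(0,0)$, using backward up-steps $(-1,1)$ and backward down-steps $(-1,-1)$: read $\pi$ from right to left; for each $m_i$ perform $m_i-m_{i-1}$ backward up-steps, and for each $w_i$ perform $|w_i|+1$ backward down-steps. (E.g. $6573142$ gives the path $UUUDDDUUUDDUDD$ read left to right.) *)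

(* Defs.v *)
From mathcomp Require Import all_boot all_order all_fingroup all_algebra.
From mathcomp Require Import zify.

Set Implicit Arguments.
Unset Strict Implicit.
Unset Printing Implicit Defensive.

Import Order.TTheory GRing.Theory Num.Theory.

(** A permutation of {1, ..., n} is [pi : 'S_n], where position and value
    [i : 'I_n] stand for [i + 1]. *)

Definition one_line n (pi : 'S_n) : seq nat :=
  [seq (pi i : nat).+1 | i <- enum 'I_n].

Definition avoids123 n (pi : 'S_n) : Prop :=
  ~ exists i j k : 'I_n, [/\ i < j, j < k, pi i < pi j & pi j < pi k].

(** [rev_ord i = n - 1 - i] is the 0-based version of [n + 1 - i]. *)
Definition backward_derangement n (pi : 'S_n) : Prop :=
  forall i : 'I_n, pi (rev_ord i) != i.

Inductive step := U | D.

Definition rise (x : step) : int := if x is U then 1%R else (-1)%R.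

Definition height (s : seq step) : int := (\sum_(x <- s) rise x)%R.

Definition is_dyck n (s : seq step) : Prop :=
  [/\ size s = n.*2, height s = 0%R & forall k, (0 <= height (take k s))%R].

Record dyck_path n := DyckPath {
  steps :> seq step;
  dyck_pathP : is_dyck n steps }.

Definition has_hill (s : seq step) : Prop :=
  exists p q : seq step, s = p ++ [:: U, D & q] /\ height p = 0%R.

Definition hill_free n (d : dyck_path n) : Prop := ~ has_hill d.

(** The factorization [w_s m_s ... w_1 m_1] of a word at its right-to-left
    maxima, as the list [(w_s, m_s); ...; (w_1, m_1)]. A letter that is not a
    right-to-left maximum is prepended to the leftmost [w]; the last branch is
    never reached. *)
Fixpoint rl_blocks (s : seq nat) : seq (seq nat * nat) :=
  if s is x :: s' then
    if all (fun y => y < x) s' then ([::], x) :: rl_blocks s'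
    else if rl_blocks s' is (w, m) :: b then (x :: w, m) :: b else [::]
  else [::].

(** The sequence of backward steps, [U] being the step (-1,1) and [D] the step
    (-1,-1), for the blocks [(w_i, m_i); (w_(i+1), m_(i+1)); ...] listed from
    right to left; [m'] is [m_(i-1)]. *)
Fixpoint backward_steps (m' : nat) (b : seq (seq nat * nat)) : seq step :=
  if b is (w, m) :: b' then
    nseq (m - m') U ++ nseq (size w).+1 D ++ backward_steps m b'
  else [::].

(** The backward step (-1,1) traversed from left to right is a down-step, and
    the backward step (-1,-1) is an up-step. *)
Definition flip (x : step) : step := if x is U then D else U.

Definition krattenthaler_steps (s : seq nat) : seq step :=
  rev (map flip (backward_steps 0 (rev (rl_blocks s)))).

Example krattenthaler_6573142 :
  krattenthaler_steps [:: 6; 5; 7; 3; 1; 4; 2] =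
  [:: U; U; U; D; D; D; U; U; U; D; D; U; D; D].
Proof. by []. Qed.

Lemma height_nil : height [::] = 0%R.
Proof. by rewrite /height big_nil. Qed.

Lemma height_cat s t : height (s ++ t) = (height s + height t)%R.
Proof. by rewrite /height big_cat. Qed.

Lemma height_rev s : height (rev s) = height s.
Proof.
elim: s => [//|x s IH].
by rewrite rev_cons -cats1 height_cat IH /height big_seq1 big_cons addrC.
Qed.

Lemma height_flip s : height (map flip s) = (- height s)%R.
Proof.
elim: s => [|x s IH]; first by rewrite height_nil.
have consE y t : height (y :: t) = (rise y + height t)%R.
  by rewrite /height big_cons.
by rewrite /= !consE IH opprD; case: x.
Qed.

Lemma height_nseqU k : height (nseq k U) = Posz k.
Proof.
by elim: k => [|k IH]; rewrite ?height_nil // -addn1 nseqD height_cat IH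
  /height big_seq1 /= PoszD.
Qed.

Lemma height_nseqD k : height (nseq k D) = (- k%:Z)%R.
Proof. by rewrite -(height_nseqU k) -height_flip map_nseq. Qed.

Lemma take_nseq_min (T : Type) k m (x : T) :
  take k (nseq m x) = nseq (minn k m) x.
Proof. by elim: m k => [|m IH] [|k] //=; rewrite IH minnSS. Qed.

Lemma rl_blocks_nil s : rl_blocks s = [::] -> s = [::].
Proof.
elim: s => [//|x s IH] /=; case: ifP => // nall.
case E: (rl_blocks s) => [|[w m] b] // _.
by rewrite (IH E) in nall.
Qed.

Lemma rl_blocksE s : flatten [seq rcons b.1 b.2 | b <- rl_blocks s] = s.
Proof.
elim: s => [//|x s IH] /=; case: ifP => [_|nall]; first by rewrite /= IH.
case E: (rl_blocks s) IH => [|[w m] b] /=; last by move=> ->.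
by move=> s0; rewrite -s0 in nall.
Qed.

Lemma head_rl_blocks (s : seq nat) :
  head 0 (map snd (rl_blocks s)) = \max_(y <- s) y.
Proof.
elim: s => [|x s IH] /=; first by rewrite big_nil.
rewrite big_cons; case: ifP => [/allP lt_x|nall] /=.
  by apply/esym/maxn_idPl/bigmax_leqP_seq => y ys _; rewrite ltnW ?lt_x.
have /allPn[y ys] := negbT nall; rewrite -leqNgt => le_xy.
have le_xM : x <= \max_(z <- s) z.
  by apply: leq_trans le_xy _; apply: leq_bigmax_seq.
rewrite (maxn_idPr le_xM) -IH.
by case: (rl_blocks s) => [|[w m] b].
Qed.

Lemma backward_steps_rcons m' b w m :
  backward_steps m' (rcons b (w, m)) =
  backward_steps m' b ++ nseq (m - last m' (map snd b)) U
    ++ nseq (size w).+1 D.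
Proof.
elim: b m' => [|[v k] b IH] m' /=; first by rewrite cats0.
by rewrite IH -!catA /= -!catA.
Qed.

Lemma last_map_rev (b : seq (seq nat * nat)) :
  last 0 (map snd (rev b)) = head 0 (map snd b).
Proof. by case: b => [//|x b]; rewrite rev_cons map_rcons last_rcons. Qed.

Lemma backward_steps_cons x s :
  backward_steps 0 (rev (rl_blocks (x :: s))) =
  backward_steps 0 (rev (rl_blocks s)) ++
    nseq (\max_(y <- x :: s) y - \max_(y <- s) y) U ++ [:: D].
Proof.
rewrite -!head_rl_blocks /=; case: ifP => [_|nall].
  by rewrite rev_cons backward_steps_rcons last_map_rev.
case E: (rl_blocks s) => [|[w m] b] /=.
  by rewrite (rl_blocks_nil E) in nall.
rewrite !rev_cons !backward_steps_rcons subnn /= -!catA.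
by rewrite -[D :: D :: _]/(nseq (size w).+2 D) -addn1 nseqD.
Qed.

Lemma size_le_max (s : seq nat) :
  uniq s -> all (leq 1) s -> size s <= \max_(y <- s) y.
Proof.
move=> us /allP pos.
rewrite -[leqRHS](size_iota 1); apply: uniq_leq_size us _ => y ys.
by rewrite mem_iota pos //= add1n ltnS; apply: leq_bigmax_seq.
Qed.

Lemma backward_stepsP (s : seq nat) : uniq s -> all (leq 1) s ->
  let B := backward_steps 0 (rev (rl_blocks s)) in
  let M := \max_(y <- s) y in
  [/\ size B = M + size s, height B = (M%:Z - (size s)%:Z)%R
    & forall k, (0 <= height (take k B))%R].
Proof.
elim: s => [|x s IH] us pos.
  by rewrite /= big_nil; split=> //= [|k]; rewrite height_nil.
have le_sz := size_le_max us pos; rewrite [size _]/= in le_sz.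
move: us pos => /= /andP[_ us] /andP[_ pos].
have [szB hB posB] := IH us pos.
rewrite -[if all _ _ then _ else _]/(rl_blocks (x :: s)) backward_steps_cons.
have leM : \max_(y <- s) y <= \max_(y <- x :: s) y.
  by rewrite big_cons leq_maxr.
set B := backward_steps _ _ in szB hB posB *.
set M := \max_(y <- s) y in szB hB leM *.
set M' := \max_(y <- _) y in le_sz leM *.
have h1 : height [:: D] = (-1)%R by rewrite (height_nseqD 1).
split=> [||k].
- by rewrite !size_cat szB size_nseq /=; lia.
- by rewrite !height_cat hB height_nseqU h1; lia.
rewrite take_cat; case: ifP => // _; rewrite height_cat hB.
rewrite take_cat size_nseq; case: ifP => _.
  have := posB (size B); rewrite take_size hB take_nseq_min height_nseqU; lia.
rewrite height_cat height_nseqU.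
case: (_ - _ - _) => [|j] /=; rewrite ?h1 ?height_nil; lia.
Qed.

Lemma one_line_perm n (pi : 'S_n) : perm_eq (one_line pi) (iota 1 n).
Proof.
apply: uniq_perm; rewrite ?iota_uniq //.
  rewrite map_inj_uniq ?enum_uniq // => i j [] /val_inj.
  exact: perm_inj.
move=> y; rewrite mem_iota add1n; apply/mapP/andP => [[i _ ->]|[y1 yn]].
  by rewrite !ltnS ltn_ord.
have lty : y.-1 < n by lia.
exists (perm_inv pi (Ordinal lty)); first by rewrite mem_enum.
by rewrite permKV /= prednK.
Qed.

Lemma krattenthaler_is_dyck n (pi : 'S_n) :
  is_dyck n (krattenthaler_steps (one_line pi)).
Proof.
have pe := one_line_perm pi; set s := one_line pi in pe *.
have us : uniq s by rewrite (perm_uniq pe) iota_uniq.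
have pos : all (leq 1) s.
  by apply/allP => y; rewrite (perm_mem pe) mem_iota => /andP[].
have sz : size s = n by rewrite (perm_size pe) size_iota.
have maxs : \max_(y <- s) y = n.
  apply/eqP; rewrite eqn_leq -{2}sz size_le_max // andbT.
  apply/bigmax_leqP_seq => y; rewrite (perm_mem pe) mem_iota => /andP[_].
  by rewrite add1n ltnS.
have [] := backward_stepsP us pos; rewrite /= maxs sz subrr addnn.
rewrite /krattenthaler_steps; set B := backward_steps _ _ => szB hB posB.
split=> [||k]; first by rewrite size_rev size_map.
  by rewrite height_rev height_flip hB oppr0.
rewrite take_rev height_rev -map_drop height_flip.
set j := (_ - _); have := height_cat (take j B) (drop j B).
by rewrite cat_take_drop hB; have := posB j; lia.
Qed.

(** The construction makes sense for every permutation; its restriction to the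
    123-avoiding ones is the bijection onto Dyck paths. *)
Definition krattenthaler n (pi : 'S_n) : dyck_path n :=
  DyckPath (krattenthaler_is_dyck pi).

(* Main.v *)
Require Import Defs.
From mathcomp Require Import all_boot all_order all_fingroup all_algebra.
From mathcomp Require Import zify.

Import Order.TTheory GRing.Theory Num.Theory.

(** Reading the path backwards, after the down-step of the [j]-th entry from
    the right the height is [M_j - j], where [M_j] is the maximum of the last
    [j] entries. Hence a hill is an index [j] with [M_j = j] and
    [M_(j+1) = j + 1], which says that the suffix of length [j] consists of
    [1, ..., j] and is preceded by the entry [j + 1]. If [pi] avoids 123 and
    has [j + 1] at position [n - j], then the suffix after it is made of
    [1, ..., j]: a larger entry there would leave room for a smaller entry on
    the left, and the three entries would form a 123. *)

Lemma flipK : involutive flip.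
Proof. by case. Qed.

(** The factor [U, D] is invariant under reversal with flipping. Since [s], [p] and the factor
    itself have height 0, so has [q], and hence so has the new prefix [rev (map flip q)]. *)
Lemma has_hill_rev_flip (s : seq step) :
  height s = 0%R -> has_hill s -> has_hill (rev (map flip s)).
Proof.
move=> hs [p [q [def_s hp]]].
exists (rev (map flip q)), (rev (map flip p)); split.
  by rewrite def_s map_cat rev_cat /= !rev_cons -!cats1 -!catA.
rewrite height_rev height_flip; move: hs.
rewrite def_s height_cat hp -[U :: _]/([:: U; D] ++ q) height_cat.
by rewrite [height [:: _; _]]/height !big_cons big_nil /=; lia.
Qed.

Lemma has_hill_rev_flipE (s : seq step) :
  height s = 0%R -> has_hill (rev (map flip s)) <-> has_hill s.
Proof.
move=> hs; split; last exact: has_hill_rev_flip.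
move=> /has_hill_rev_flip; rewrite map_rev revK (mapK flipK); apply.
by rewrite height_rev height_flip hs oppr0.
Qed.

Lemma has_hill_catl (s t : seq step) : has_hill s -> has_hill (s ++ t).
Proof. by case=> p [q [-> hp]]; exists p, (q ++ t); rewrite -catA. Qed.

Lemma has_hill_cat_nseqU (s : seq step) k :
  has_hill (s ++ nseq k U) -> has_hill s.
Proof.
elim: k => [|k IH]; first by rewrite cats0.
rewrite -addn1 nseqD catA cats1 => -[p [q [def_s hp]]]; apply: IH.
case: (lastP q) def_s => [|q' y] def_s.
  by have := congr1 (last D) def_s; rewrite last_rcons last_cat.
rewrite -!rcons_cons -rcons_cat in def_s.
by have [def_s' _] := rcons_inj def_s; exists p, q'.
Qed.

(** This is the effect of one more entry on the backward path. A new hill must end at the appended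
    [D], and its [U] is the last of the [k] up-steps because [s] is empty or ends in [D]. It starts
    at height [height s + k - 1], a sum of nonnegative terms. *)
Lemma has_hill_cat_nseqU_D (s : seq step) k :
    last D s = D -> (0 <= height s)%R ->
  has_hill (s ++ nseq k U ++ [:: D]) <->
  has_hill s \/ height s = 0%R /\ k = 1.
Proof.
move=> lastD hs; split=> [[p [q [def_s hp]]]|[|[hs0 ->]]]; last 1 first.
- by exists s, [::].
- case: (lastP q) def_s => [|q' y] def_s; last first.
    left; apply: (@has_hill_cat_nseqU s k); exists p, q'; split=> //.
    rewrite -!rcons_cons -rcons_cat catA cats1 in def_s.
    by have [] := rcons_inj def_s.
  right; rewrite catA cats1 -[[:: U; D]]/(rcons [:: U] D) -rcons_cat in def_s.
  have [] := rcons_inj def_s; case: k {def_s} => [|k] def_s.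
    move: lastD; rewrite -[s]cats0 -[[::]]/(nseq 0 U) def_s.
    by rewrite last_cat.
  rewrite -addn1 nseqD catA !cats1 in def_s.
  have [def_p] := rcons_inj def_s.
  by move: hp; rewrite -def_p height_cat height_nseqU; lia.
- exact: has_hill_catl.
Qed.

Lemma last_backward_steps (s : seq nat) :
  last D (backward_steps 0 (rev (rl_blocks s))) = D.
Proof. by case: s => [//|x s]; rewrite backward_steps_cons !last_cat. Qed.

Lemma has_hill_backward_steps (s : seq nat) : uniq s -> all (leq 1) s ->
  has_hill (backward_steps 0 (rev (rl_blocks s))) <->
  exists u x t, [/\ s = u ++ x :: t, x = (size t).+1
                  & \max_(y <- t) y = size t].
Proof.
elim: s => [_ _|x s IH us pos].
  by split=> [[[|? ?] [? []]]|[[|? ?] [? [? []]]]].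
rewrite backward_steps_cons.
have /andP[_ us'] : (x \notin s) && uniq s := us.
have /andP[_ pos'] : (0 < x) && all (leq 1) s := pos.
have [_ hB posB] := backward_stepsP us' pos'.
have hB0 : (0 <= height (backward_steps 0 (rev (rl_blocks s))))%R.
  by rewrite -[X in height X]take_size.
(* With [M] the maximum of [s], the new entry creates a hill iff [M = size s] and
   [maxn x M - M = 1], that is, [x = M + 1]: the case of empty [u]. *)
rewrite has_hill_cat_nseqU_D ?last_backward_steps // hB IH // big_cons.
split=> [[[u [y [t [-> def_y maxt]]]]|[hM hk]]|[u [y [t [def_s def_y maxt]]]]].
- by exists (x :: u), y, t.
- by exists [::], x, s; split=> //; lia.
case: u def_s => [|z u] [def_x def_s]; last by left; exists u, y, t.
by right; rewrite def_s def_x; lia.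
Qed.

Lemma has_hill_krattenthaler n (pi : 'S_n) :
  has_hill (krattenthaler pi) <->
  exists u x t, [/\ one_line pi = u ++ x :: t, x = (size t).+1
                  & \max_(y <- t) y = size t].
Proof.
have pe := one_line_perm pi.
have us : uniq (one_line pi) by rewrite (perm_uniq pe) iota_uniq.
have pos : all (leq 1) (one_line pi).
  by apply/allP => y; rewrite (perm_mem pe) mem_iota => /andP[].
rewrite -has_hill_backward_steps //= /krattenthaler_steps.
apply: has_hill_rev_flipE.
have [_ + _] := krattenthaler_is_dyck pi.
by rewrite /krattenthaler_steps height_rev height_flip; lia.
Qed.

Lemma size_one_line n (pi : 'S_n) : size (one_line pi) = n.
Proof. by rewrite size_map size_enum_ord. Qed.

Lemma nth_one_line n (pi : 'S_n) (i : 'I_n) :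
  nth 0 (one_line pi) i = (pi i).+1.
Proof. by rewrite (nth_map i) ?size_enum_ord // nth_ord_enum. Qed.

Lemma avoids123_le_after n (pi : 'S_n) (i k : 'I_n) : avoids123 pi ->
  pi (rev_ord i) = i -> rev_ord i < k -> pi k < i.
Proof.
move=> av pi_i lt_k; rewrite ltnNge; apply/negP => le_ik.
have lt_ik : i < pi k.
  rewrite ltn_neqAle le_ik andbT -[X in X != _]/(val i) -pi_i.
  by rewrite (inj_eq val_inj) (inj_eq perm_inj) -(inj_eq val_inj) neq_ltn lt_k.
(* As a set of values, [small] pulls back along [pi] to the positions of the small entries; along
   [rev_ord], to the positions after [rev_ord i]. *)
pose small := [set v : 'I_n | v < i].
have mem_after j : (j \in @rev_ord n @^-1: small) = (rev_ord i < j).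
  by rewrite !inE /=; have := ltn_ord i; have := ltn_ord j; lia.
have sub_after : pi @^-1: small \subset @rev_ord n @^-1: small.
  apply/subsetP => j; rewrite mem_after !inE => lt_j.
  rewrite ltnNge; apply/negP => le_j; apply: av.
  exists j, (rev_ord i), k; rewrite pi_i; split=> //.
  rewrite ltn_neqAle le_j andbT (inj_eq val_inj); apply/eqP => j_i.
  by rewrite j_i pi_i ltnn in lt_j.
(* Both preimages have as many elements as [small], so the inclusion is an equality; but [k] lies
   only in the second. *)
have /eqP eq_after : pi @^-1: small == @rev_ord n @^-1: small.
  rewrite eqEcard sub_after (card_preimset small (@perm_inj _ pi)) /=.
  by rewrite (card_preimset small (@rev_ord_inj n)) leqnn.
by have := mem_after k; rewrite lt_k -eq_after !inE ltnNge le_ik.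
Qed.

Lemma has_hillP n (pi : 'S_n) : avoids123 pi ->
  has_hill (krattenthaler pi) <-> exists i, pi (rev_ord i) = i.
Proof.
move=> av; rewrite has_hill_krattenthaler.
have sz := size_one_line _ pi.
split=> [[u [x [t [def_s def_x _]]]]|[i pi_i]].
  rewrite def_s size_cat /= in sz.
  have sz_t : size t < n by lia.
  (* The entry [x] is the 0-based value [size t], at position [size u = n - 1 - size t]. *)
  exists (Ordinal sz_t); apply: val_inj; apply: succn_inj.
  rewrite -nth_one_line def_s /= (_ : n - _ = size u); last by lia.
  by rewrite nth_cat ltnn subnn /= def_x.
pose j := rev_ord i; pose t := drop j.+1 (one_line pi).
have sz_t : size t = i by rewrite size_drop sz /=; have := ltn_ord i; lia.
exists (take j (one_line pi)), i.+1, t.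
have def_s : one_line pi = take j (one_line pi) ++ i.+1 :: t.
  by rewrite -{1}pi_i -nth_one_line -drop_nth ?sz // cat_take_drop.
split; rewrite ?sz_t //.
have pe := one_line_perm pi.
have sub_t : {subset t <= one_line pi} by move=> y; apply: mem_drop.
(* Distinct positive entries give the lower bound on the maximum; avoidance of 123 gives the upper
   one. *)
apply/eqP; rewrite eqn_leq -{2}sz_t size_le_max ?andbT.
- apply/bigmax_leqP_seq => y /(nthP 0)[l lt_l <-] _.
  rewrite nth_drop; have lt_n : j.+1 + l < n.
    by move: lt_l; rewrite size_drop sz; lia.
  rewrite -[j.+1 + l]/(val (Ordinal lt_n)) nth_one_line.
  by apply: avoids123_le_after => //=; rewrite -/(val j); lia.
- by rewrite drop_uniq // (perm_uniq pe) iota_uniq.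
- by apply/allP => y /sub_t; rewrite (perm_mem pe) mem_iota => /andP[].
Qed.

Theorem theorem3p2 (n : nat) (pi : 'S_n) (pi_av : avoids123 pi) :
  backward_derangement pi <-> hill_free (krattenthaler pi).
Proof.
rewrite /hill_free has_hillP //; split=> [der [i pi_i]|noex i].
  by have := der i; rewrite pi_i eqxx.
by apply/eqP => pi_i; apply: noex; exists i.
Qed.
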